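(* There is a weight-preserving bijection between $\mathcal{O}_n$ and $\mathcal{T}_n$.
   Context: A complete monotone triangle of order $n$ is a triangular array of integers with $n$ rows and $k$ entries in the $k$-th row, each row strictly increasing, the final row being $1,2,\ldots,n$ in ascending order, and each entry not in the final row lying weakly between the entries immediately to its left and right in the row below. For an entry $j$ not in the bottom row with neighbours $i$ (below left) and $k$ (below right), exactly one of the following holds: (i) $i=j<k$, (ii) $i<j=k$, (iii) $i<j<k$. An oriented complete monotone triangle is a complete monotone triangle in which each entry not in the bottom row is given an orientation (left or right), where entries of type (i) must be oriented right, entries of type (ii) must be oriented left, and entries of type (iii) may be oriented either way. $\mathcal{O}_n$ denotes the set of oriented complete monotone triangles of order $n$. The weight of such a triangle is the product, over all entries not in the bottom row, of $x_j$ for each right-oriented entry $j$ and $y_j$ for each left-oriented entry $j$ (with $x_1,\ldots,x_n,y_1,\ldots,y_n$ indeterminates). $\mathcal{T}_n$ denotes the set of tournaments on $\{1,2,\ldots,n\}$, i.e. orientations of the complete graph on this vertex set. The weight of a tournament is the product of the weights of its edges, where an edge oriented from $i$ to $j$ has weight $x_i$ if $i<j$ and $y_i$ if $i>j$. *)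

(* Defs.v *)
From mathcomp Require Import all_boot all_order all_algebra.
From mathcomp Require Export mpoly.

Set Implicit Arguments.
Unset Strict Implicit.
Unset Printing Implicit Defensive.

Import Order.TTheory GRing.Theory Num.Theory.
Local Open Scope ring_scope.

(* The 2n indeterminates x_1, ..., x_n, y_1, ..., y_n are the variables        *)
(* 0, ..., n-1 and n, ..., 2n-1 of {mpoly int[n + n]}.  xvar and yvar take the *)
(* 1-based label j; the value 0 off {1, ..., n} is never used, by              *)
(* complete_monotone_entry_range.                                              *)
Definition xvar (n : nat) (j : int) : {mpoly int[n + n]} :=
  if [pick i : 'I_n | i.+1%:Z == j] is Some i then 'X_(lshift n i) else 0.

Definition yvar (n : nat) (j : int) : {mpoly int[n + n]} :=
  if [pick i : 'I_n | i.+1%:Z == j] is Some i then 'X_(rshift n i) else 0.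

(* Rows are listed from the top and everything is 0-based: row k has k.+1      *)
(* entries, and the neighbours of entry i of row k in the row below are        *)
(* entries i and i.+1 of row k.+1.                                             *)
Definition entry (T : seq (seq int)) (k i : nat) : int := nth 0 (nth [::] T k) i.

Definition complete_monotone (n : nat) (T : seq (seq int)) : bool :=
  [&& shape T == iota 1 n,
      all (sorted (fun a b : int => a < b)) T,
      last [::] T == [seq j%:Z | j <- iota 1 n]
    & [forall k : 'I_n.-1, forall i : 'I_k.+1,
         entry T k.+1 i <= entry T k i <= entry T k.+1 i.+1]].

(* Orientations of the entries outside the bottom row: true is right, false is *)
(* left.                                                                       *)
Definition orient (D : seq (seq bool)) (k i : nat) : bool :=
  nth false (nth [::] D k) i.

Definition admissible_orientation (n : nat) (T : seq (seq int))
    (D : seq (seq bool)) : bool :=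
  (shape D == iota 1 n.-1) &&
  [forall k : 'I_n.-1, forall i : 'I_k.+1,
     (((entry T k.+1 i == entry T k i) && (entry T k i < entry T k.+1 i.+1))
        ==> orient D k i)
  && (((entry T k.+1 i < entry T k i) && (entry T k i == entry T k.+1 i.+1))
        ==> ~~ orient D k i)].

Definition oriented_triangle (n : nat) : Type :=
  {TD : seq (seq int) * seq (seq bool) |
    complete_monotone n TD.1 && admissible_orientation n TD.1 TD.2}.

Definition triangle_weight (n : nat) (o : oriented_triangle n) :
    {mpoly int[n + n]} :=
  let T := (val o).1 in
  let D := (val o).2 in
  \prod_(k < n.-1) \prod_(i < k.+1)
    (if orient D k i then xvar n (entry T k i) else yvar n (entry T k i)).

(* The ordinal i stands for the vertex i.+1, and (i, j) \in t says that the    *)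
(* edge joining i and j is oriented from i to j.                               *)
Definition is_tournament (n : nat) (t : {set 'I_n * 'I_n}) : bool :=
  [forall i, (i, i) \notin t] &&
  [forall i, forall j, (i != j) ==> ((i, j) \in t) (+) ((j, i) \in t)].

Definition tournament (n : nat) : Type :=
  {t : {set 'I_n * 'I_n} | is_tournament t}.

Definition tournament_weight (n : nat) (t : tournament n) :
    {mpoly int[n + n]} :=
  \prod_(e in val t)
    (if (e.1 < e.2)%N then xvar n e.1.+1%:Z else yvar n e.1.+1%:Z).

Lemma complete_monotone_entry_range (n : nat) (T : seq (seq int)) (k i : nat) :
  complete_monotone n T -> (k < n)%N -> (i <= k)%N ->
  1 <= entry T k i <= n%:Z.
Proof.
case/and4P=> /eqP shT _ /eqP lastT /forallP interl.
have szT : size T = n by rewrite -(size_map size) -/(shape T) shT size_iota.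
case: n => [//|n] in shT lastT interl szT *; rewrite ltnS => le_kn.
move: i; rewrite -(subKn le_kn); move: (n - k)%N (leq_subr k n) => {le_kn} d.
elim: d => [_|d IHd lt_dn] i.
  rewrite subn0 => le_in; rewrite /entry.
  have -> : nth [::] T n = last [::] T by rewrite -nth_last szT.
  rewrite lastT.
  have -> : nth 0 [seq j%:Z | j <- iota 1 n.+1] i = (1 + i)%N%:Z.
    by rewrite (nth_map 0%N) ?size_iota ?nth_iota.
  by apply/andP; split.
have Ed : (n - d = (n - d.+1).+1)%N by rewrite -subSn // subSS.
have lt_k : (n - d.+1 < n)%N by rewrite -Ed leq_subr.
move=> le_i; have lt_i : (i < (n - d.+1).+1)%N by [].
have /forallP/(_ (Ordinal lt_i))/andP[/= lo hi] := interl (Ordinal lt_k).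
have := IHd (ltnW lt_dn); rewrite Ed => IH.
have /andP[lo' _] := IH i (leqW le_i); have /andP[_ hi'] := IH i.+1 le_i.
by rewrite (le_trans lo' lo) (le_trans hi hi').
Qed.

(* Main.v *)
Require Import Defs.
From mathcomp Require Import all_boot all_order all_algebra.
From mathcomp Require Import perm mpoly ring zify.

Set Implicit Arguments.
Unset Strict Implicit.
Unset Printing Implicit Defensive.

Import Order.TTheory GRing.Theory Num.Theory.
Local Open Scope ring_scope.

(* All weights are monomials, so it suffices that the two families have the    *)
(* same total weight prod_(i < j) (x_i + y_j); for tournaments this is the     *)
(* expansion of the product.  For triangles one proves more: let c_j(t) be the *)
(* coefficient of z^j in                                                       *)
(*   q_t = prod_(s < t) (1 + x_s z) * prod_(t < s <= n) (1 - y_s z).           *)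
(* The oriented monotone triangles with bottom row s_0 < ... < s_m have total  *)
(* weight det (c_j(s_i)).  Indeed q_(t+1) - q_t = z (x_t q_t + y_(t+1) q_(t+1))*)
(* makes the sum over the admissible values of an entry between a and b        *)
(* telescope to c_(j+1)(b) - c_(j+1)(a), and since c_0 = 1 the determinant of  *)
(* these row differences is the determinant for the row below.  For the bottom *)
(* row 1, ..., n the difference is also z (x_t + y_(t+1)) q'_t, where q' is    *)
(* the family of order n - 1 with y shifted by one, so the determinant is      *)
(* evaluated by induction on n.                                                *)

(** The bijection is not explicit. In a sum of monic monomials each coefficient is a natural number
    counting occurrences, so nothing cancels and equal totals mean equal multisets of weights
    ([perm_eq_monomials]); matching equal weights then gives the bijection ([perm_map_bijective]).
    The triangle total is a determinant by induction on the number of rows ([sum_triangles]):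
    multilinearity ([sum_selections_det]) moves the sum over a row inside the determinant, each
    entry telescopes ([sum_cell]), and [det_row_diff] returns to the row below. [det_factor_poly]
    evaluates the result, and [sum_tournaments] gives the same product. *)

(** The unitriangular matrix [L] subtracts from each row its predecessor, which turns the column of
    ones into the first unit vector; expand along that column. *)
Lemma det_row_diff (R : comNzRingType) k (M : 'M[R]_k.+1) :
    (forall i, M i ord0 = 1) ->
  \det M = \det (\matrix_(i < k, j < k)
    (M (lift ord0 i) (lift ord0 j) - M (widen_ord (leqnSn k) i) (lift ord0 j))).
Proof.
move=> M1.
pose L : 'M[R]_k.+1 := \matrix_(i, j) ((i == j)%:R - (i == j.+1 :> nat)%:R).
have detL : \det L = 1.
  rewrite det_trig; last first.
    apply/is_trig_mxP => i j lt_ij; rewrite mxE -val_eqE /=.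
    by rewrite ltn_eqF // (ltn_eqF (ltnW _)) // subrr.
  by apply: big1 => i _; rewrite mxE eqxx ltn_eqF // subr0.
have LM i j : (L *m M) i j = M i j - \sum_(l < k.+1 | i == l.+1 :> nat) M l j.
  rewrite mxE; under eq_bigr => l _ do rewrite mxE mulrBl.
  rewrite sumrB; congr (_ - _).
    rewrite (bigD1 i) //= eqxx mul1r big1 ?addr0 // => l /negPf.
    by rewrite eq_sym => ->; rewrite mul0r.
  rewrite [RHS]big_mkcond /=; apply: eq_bigr => l _.
  by case: ifP => _; rewrite ?mul1r ?mul0r.
have LM0 j : (L *m M) ord0 j = M ord0 j by rewrite LM big_pred0 ?subr0.
have LMS i j :
    (L *m M) (lift ord0 i) j = M (lift ord0 i) j - M (widen_ord (leqnSn k) i) j.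
  by rewrite LM (big_pred1 (widen_ord (leqnSn k) i)).
rewrite -[LHS]mul1r -detL -det_mulmx (expand_det_col _ ord0) big_ord_recl.
rewrite big1 ?addr0 => [|i _]; last by rewrite LMS !M1 subrr mul0r.
rewrite LM0 M1 mul1r /cofactor expr0 mul1r; congr (\det _).
by apply/matrixP => i j; rewrite !mxE -LMS !mxE.
Qed.

Section FactorPolynomials.
Variables (R : comNzRingType) (x : nat -> R).

(** This is q_t with labels counted from 0. Unlike [x], the family [y] is an argument, since the
    induction on [n] shifts it. *)
Definition factor_poly (n : nat) (y : nat -> R) (t : nat) : {poly R} :=
  \prod_(0 <= s < t) (1 + x s *: 'X) * \prod_(t.+1 <= s < n) (1 - y s *: 'X).

Lemma coef0_factor_poly n y t : (factor_poly n y t)`_0 = 1.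
Proof.
rewrite -horner_coef0 hornerM !horner_prod.
by rewrite !big1 ?mulr1 // => s _; rewrite !hornerE ?mulr0 ?subr0 ?addr0.
Qed.

(** Consecutive q_t and q_(t+1) share the factor on the right-hand side, of order [n] with [y]
    shifted; the cofactors are 1 - y_(t+1) z and 1 + x_t z. The same factorisation yields
    [factor_polyD]. *)
Lemma factor_polyB n y t : (t < n)%N ->
  factor_poly n.+1 y t.+1 - factor_poly n.+1 y t =
  (x t + y t.+1) *: ('X * factor_poly n (fun s => y s.+1) t).
Proof.
move=> lt_tn; rewrite /factor_poly (big_nat_recr t) //= (@big_ltn _ _ _ t.+1) //.
rewrite (big_add1 _ _ t.+1) /= -!mul_polyC polyCD; ring.
Qed.

Lemma factor_polyD n y t : (t < n)%N ->
  x t *: factor_poly n.+1 y t + y t.+1 *: factor_poly n.+1 y t.+1 =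
  (x t + y t.+1) *: factor_poly n (fun s => y s.+1) t.
Proof.
move=> lt_tn; rewrite /factor_poly (big_nat_recr t) //= (@big_ltn _ _ _ t.+1) //.
rewrite (big_add1 _ _ t.+1) /= -!mul_polyC polyCD; ring.
Qed.

Lemma det_factor_poly n y :
  \det (\matrix_(i < n, j < n) (factor_poly n y i)`_j) =
  \prod_(i < n) \prod_(j < n | (i < j)%N) (x i + y j).
Proof.
elim: n y => [|n IHn] y; first by rewrite det_mx00 big_ord0.
rewrite det_row_diff => [|i]; last by rewrite mxE coef0_factor_poly.
pose d : 'rV[R]_n := \row_i (x i + y i.+1).
rewrite [X in \det X](_ : _ = diag_mx d *m
  \matrix_(i < n, j < n) (factor_poly n (fun s => y s.+1) i)`_j); last first.
  apply/matrixP => i j; rewrite mul_diag_mx !mxE -coefB /= factor_polyB //.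
  by rewrite coefZ coefXM.
(* For each i < n the diagonal matrix supplies the factor for j = i + 1 and the shifted induction
   hypothesis those for j > i + 1; the last i has no larger j. *)
rewrite det_mulmx det_diag IHn -big_split big_ord_recr /=.
rewrite [X in _ = _ * X]big1 ?mulr1 => [|j]; last by rewrite ltnNge -ltnS ltn_ord.
apply: eq_bigr => i _; rewrite [RHS]big_mkcond big_ord_recl /= mul1r -big_mkcond /=.
rewrite mxE [RHS](bigD1 i) //=; congr (_ * _); apply: eq_bigl => j.
by rewrite ltn_neqAle andbC eq_sym.
Qed.

End FactorPolynomials.

(** * Cartesian products of lists and multilinearity of the determinant *)

Section Selections.
Variable A : eqType.
Implicit Types (L : seq (seq A)) (r : seq A).

Fixpoint selections L : seq (seq A) :=
  if L is l :: L' then [seq a :: r | a <- l, r <- selections L'] else [:: [::]].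

Lemma mem_selections a0 L r :
  reflect (size r = size L /\
           forall i, (i < size L)%N -> nth a0 r i \in nth [::] L i)
          (r \in selections L).
Proof.
elim: L r => [|l L IHL] r /=.
  by rewrite inE; apply: (iffP eqP) => [->//|[/size0nil]].
apply: (iffP allpairsP) => [[[a r'] [/= al /IHL[szr rL] ->]]|].
  by split=> [|[|i]] /=; rewrite ?szr // => /rL.
case: r => [[]//|a r [[szr] rL]]; exists (a, r); split=> //=.
  exact: (rL 0).
by apply/IHL; split=> // i; apply: (rL i.+1).
Qed.

Lemma selections_uniq L : all uniq L -> uniq (selections L).
Proof.
elim: L => //= l L IHL /andP[ul uL]; apply: allpairs_uniq => //; first exact: IHL.
by move=> [a r] [b s] _ _ /= [-> ->].
Qed.

Lemma sum_selections (R : comNzRingType) a0 L (g : nat -> A -> R) :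
  \sum_(r <- selections L) \prod_(i < size L) g i (nth a0 r i) =
  \prod_(i < size L) \sum_(a <- nth [::] L i) g i a.
Proof.
elim: L g => [|l L IHL] g /=; first by rewrite big_seq1 !big_ord0.
rewrite big_allpairs_dep big_ord_recl -(IHL (fun i => g i.+1)) big_distrl /=.
apply: eq_bigr => a _; rewrite big_distrr /=; apply: eq_bigr => r _.
by rewrite big_ord_recl.
Qed.

(** Multilinearity in the rows: in the Leibniz formula, the term of each permutation factors over
    the rows by [sum_selections]. *)
Lemma sum_selections_det (R : comNzRingType) a0 k L (w : A -> R)
    (c : nat -> A -> R) : size L = k ->
  \sum_(r <- selections L) (\prod_(i < k) w (nth a0 r i)) *
     \det (\matrix_(i < k, j < k) c j (nth a0 r i)) =
  \det (\matrix_(i < k, j < k) \sum_(a <- nth [::] L i) w a * c j a).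
Proof.
move=> <-; rewrite /(\det _); under eq_bigr => r _ do rewrite big_distrr /=.
rewrite exchange_big /=; apply: eq_bigr => s _.
under eq_bigr => r _.
  rewrite mulrCA -big_split /=.
  under [X in _ * X]eq_bigr => i _ do rewrite mxE.
  over.
rewrite -big_distrr /=; congr (_ * _).
(* [sum_selections] wants weights indexed by [nat]; [inord] extends the permutation [s] to [nat],
   but only when the size is a successor. *)
case: L s => [|l L] s; first by rewrite big_seq1 !big_ord0.
transitivity (\prod_(i < size (l :: L)) \sum_(a <- nth [::] (l :: L) i)
    w a * c (s (inord i)) a); last first.
  by apply: eq_bigr => i _; rewrite mxE; apply: eq_bigr => a _; rewrite inord_val.
rewrite -(sum_selections a0 (l :: L) (fun i a => w a * c (s (inord i)) a)).
by apply: eq_bigr => r _; apply: eq_bigr => i _; rewrite inord_val.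
Qed.

End Selections.

(** * Enumeration of oriented triangles with a given bottom row *)

Local Notation strict := (sorted (fun a b : int => a < b)).

(* For a < b this merges interlacing with the orientation rules (i)-(iii).     *)
Definition in_cell (a b : int) (p : int * bool) : bool :=
  if p.2 then a <= p.1 < b else a < p.1 <= b.

Definition cell (a b : int) : seq (int * bool) :=
  [seq (a + i%:Z, true) | i <- iota 0 `|b - a|] ++
  [seq (a + i.+1%:Z, false) | i <- iota 0 `|b - a|].

Lemma mem_cell a b p : a <= b -> (p \in cell a b) = in_cell a b p.
Proof.
case: p => z d le_ab; rewrite mem_cat /in_cell /=.
apply/orP/idP => [[]/mapP[i]|].
- by rewrite mem_iota => ? [-> ->]; lia.
- by rewrite mem_iota => ? [-> ->]; lia.
case: d => z_ab; [left | right]; apply/mapP.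
  by exists `|z - a|%N; rewrite ?mem_iota; [lia | congr (_, _); lia].
by exists `|z - a|.-1%N; rewrite ?mem_iota; [lia | congr (_, _); lia].
Qed.

Lemma cell_uniq a b : uniq (cell a b).
Proof.
rewrite cat_uniq !map_inj_uniq ?iota_uniq => [|i j [] /addrI[]|i j [] /addrI[]] //.
rewrite andbT; apply/hasPn => p /mapP[i _ ->].
by apply/negP => /mapP[j _ []].
Qed.

Definition row_cells (s : seq int) : seq (seq (int * bool)) :=
  [seq cell (nth 0 s i) (nth 0 s i.+1) | i <- iota 0 (size s).-1].

Definition oriented_rows (s : seq int) : seq (seq (int * bool)) :=
  [seq r <- selections (row_cells s) | strict (unzip1 r)].

(** The row above [s] is chosen together with its orientations, and serves as the bottom row of a
    smaller triangle. *)
Fixpoint triangles (m : nat) (s : seq int) :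
    seq (seq (seq int) * seq (seq bool)) :=
  if m is m'.+1 then
    [seq (rcons p.1 s, rcons p.2 (unzip2 r)) |
       r <- oriented_rows s, p <- triangles m' (unzip1 r)]
  else [:: ([:: s], [::])].

Lemma strict_nth s i : strict s -> (i.+1 < size s)%N -> nth 0 s i < nth 0 s i.+1.
Proof. by move/(sortedP (0 : int)); apply. Qed.

Lemma size_row_cells s : size (row_cells s) = (size s).-1.
Proof. by rewrite size_map size_iota. Qed.

Lemma nth_row_cells s i : (i < (size s).-1)%N ->
  nth [::] (row_cells s) i = cell (nth 0 s i) (nth 0 s i.+1).
Proof. by move=> lt_i; rewrite (nth_map 0%N) ?size_iota // nth_iota. Qed.

Lemma mem_row_selections s r : strict s ->
  reflect (size r = (size s).-1 /\
           forall i, (i < (size s).-1)%N ->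
             in_cell (nth 0 s i) (nth 0 s i.+1) (nth (0, false) r i))
          (r \in selections (row_cells s)).
Proof.
move=> ss; apply: (iffP (mem_selections (0, false) _ _)).
all: rewrite size_row_cells => -[szr rs]; split=> // i lt_i.
all: have lt_s : nth 0 s i < nth 0 s i.+1 by apply: strict_nth => //; lia.
  by rewrite -mem_cell ?ltW // -nth_row_cells // rs.
by rewrite nth_row_cells // mem_cell ?ltW // rs.
Qed.

(** The bottom row is arbitrary because removing the last row of a complete triangle leaves one
    whose bottom row need not be an initial segment. *)
Definition valid_triangle m s (T : seq (seq int)) (D : seq (seq bool)) : Prop :=
  [/\ shape T = iota 1 m.+1, all strict T, last [::] T = s, shape D = iota 1 m
    & forall k i, (k < m)%N -> (i <= k)%N ->
        in_cell (entry T k.+1 i) (entry T k.+1 i.+1) (entry T k i, orient D k i)].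

Lemma shape_size (A : Type) (T : seq (seq A)) m : shape T = iota 1 m -> size T = m.
Proof. by move/(congr1 size); rewrite size_map size_iota. Qed.

Lemma shape_rcons_iota (A : Type) (T : seq (seq A)) t m :
  shape (rcons T t) = iota 1 m.+1 <-> shape T = iota 1 m /\ size t = m.+1.
Proof.
have -> : iota 1 m.+1 = rcons (iota 1 m) m.+1.
  by rewrite -cats1 -[in LHS](addn1 m) iotaD.
rewrite /shape map_rcons.
by split=> [/rcons_inj[]|[-> ->]].
Qed.

Lemma valid_triangle_rcons m s s' T D d :
  valid_triangle m.+1 s (rcons T s') (rcons D d) <->
  [/\ s' = s, strict s, size s = m.+2, size d = m.+1
    & valid_triangle m (last [::] T) T D /\
      forall i, (i <= m)%N ->
        in_cell (nth 0 s i) (nth 0 s i.+1)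
                (nth 0 (last [::] T) i, nth false d i)].
Proof.
have nthS (szT : size T = m.+1) : nth [::] (rcons T s') m.+1 = s'.
  by rewrite nth_rcons szT ltnn eqxx.
have nthT k : size T = m.+1 -> (k <= m)%N ->
    nth [::] (rcons T s') k = nth [::] T k.
  by move=> szT le_k; rewrite nth_rcons szT ltnS le_k.
have nthD k : size D = m -> (k < m)%N -> nth [::] (rcons D d) k = nth [::] D k.
  by move=> szD le_k; rewrite nth_rcons szD le_k.
have nthd : size D = m -> nth [::] (rcons D d) m = d.
  by move=> szD; rewrite nth_rcons szD ltnn eqxx.
have lastE : size T = m.+1 -> nth [::] T m = last [::] T.
  by move=> szT; rewrite -nth_last szT.
rewrite /valid_triangle last_rcons all_rcons; split.
  case=> /shape_rcons_iota[shT szs'] /andP[ss' sT] <- /shape_rcons_iota[shD szd] H.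
  have szT := shape_size shT; have szD := shape_size shD.
  split=> //; split; first split=> //.
    move=> k i lt_k le_i; have := H k i (ltnW lt_k) le_i.
    by rewrite /entry /orient !nthT ?nthD // ltnW.
  move=> i le_i; have := H m i (ltnSn m) le_i.
  by rewrite /entry /orient nthS // nthT // nthd // lastE.
case=> <- ss szs szd [[shT sT _ shD H] Hs].
have szT := shape_size shT; have szD := shape_size shD.
split; rewrite ?ss //.
- by apply/shape_rcons_iota.
- by apply/shape_rcons_iota.
move=> k i; rewrite ltnS leq_eqVlt => /predU1P[-> le_i|lt_k le_i].
  have := Hs i le_i; rewrite /entry /orient nthd // (nthT m) // lastE //.
  by rewrite nth_rcons szT ltnn eqxx.
have := H k i lt_k le_i; rewrite /entry /orient nthD //.
by rewrite !nth_rcons szT !ltnS lt_k (ltnW lt_k).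
Qed.

Lemma mem_triangles m s p : size s = m.+1 -> strict s ->
  p \in triangles m s <-> valid_triangle m s p.1 p.2.
Proof.
elim: m s p => [|m IHm] s p szs ss /=.
  rewrite inE; split=> [/eqP-> /=|]; first by split; rewrite /= ?szs ?ss.
  case: p => -[|t [|? ?]] [|d D] [] //= [szt] _ Et _ _.
  by rewrite -Et.
split=> [/allpairsPdep[r [q [rs qr ->]]]|] /=.
  move: rs; rewrite mem_filter => /andP[sr /(mem_row_selections _ ss)[]].
  rewrite szs /= => szr rs.
  have /IHm : q \in triangles m (unzip1 r) by [].
  rewrite size_map => /(_ szr sr) vq; have [_ _ lastq _ _] := vq.
  apply/valid_triangle_rcons; split=> //; rewrite ?size_map ?lastq //.
  split=> // i le_i; have := rs i le_i.
  by rewrite (nth_map (0, false)) ?szr // (nth_map (0, false)) ?szr.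
case: p => T D /= v.
have [] := v; case/lastP: T v => // T s' v; case/lastP: D v => // D d v _ _ _ _ _.
have [-> _ _ szd [vT Hs]] := (valid_triangle_rcons _ _ _ _ _ _).1 v.
have [shT sT _ shD _] := vT.
set t := last [::] T in vT Hs.
have szt : size t = m.+1.
  have := congr1 (nth 0%N ^~ m) shT; have szT := shape_size shT.
  by rewrite nth_iota // /shape (nth_map [::]) ?szT // /t -nth_last szT.
have st : strict t.
  move/allP: sT; apply; rewrite /t.
  by case: (T) (shape_size shT) => // a T' _; rewrite /= mem_last.
(* The chosen oriented row is the last but one row [t] paired with the last orientation row [d]. *)
apply/allpairsPdep; exists (zip t d), (T, D).
have Et : unzip1 (zip t d) = t by rewrite unzip1_zip // szt szd.
have Ed : unzip2 (zip t d) = d by rewrite unzip2_zip // szt szd.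
rewrite /= Ed Et; split=> //; last exact/IHm.
rewrite mem_filter Et st; apply/mem_row_selections => //.
rewrite size_zip szt szd minnn szs; split=> // i lt_i.
by rewrite nth_zip ?szt ?szd //; apply: Hs.
Qed.

(** The choices can be read off a triangle: [unzip1 r] is the bottom row of the smaller triangle,
    and [unzip2 r] the last row of orientations. *)
Lemma triangles_uniq m s : size s = m.+1 -> strict s -> uniq (triangles m s).
Proof.
elim: m s => //= m IHm s szs ss.
have rowP r : r \in oriented_rows s -> size (unzip1 r) = m.+1 /\ strict (unzip1 r).
  rewrite mem_filter => /andP[sr /(mem_row_selections _ ss)[szr _]].
  by rewrite size_map szr szs.
apply: allpairs_uniq_dep => [|r /rowP[szr sr]|].
- apply/filter_uniq/selections_uniq/allP => l /mapP[i _ ->]; exact: cell_uniq.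
- exact: IHm.
move=> _ _ /allpairsPdep[r [p [rs pr ->]]] /allpairsPdep[r' [p' [rs' pr' ->]]] /=.
case=> /rcons_inj[ET] /rcons_inj[ED Er2].
have [szr sr] := rowP _ rs; have [szr' sr'] := rowP _ rs'.
have [_ _ Er _ _] := (mem_triangles _ szr sr).1 pr.
have [_ _ Er' _ _] := (mem_triangles _ szr' sr').1 pr'.
have Err : r = r' by rewrite -[r]zip_unzip -[r']zip_unzip Er2 -Er -Er' ET.
by case: p ET ED {pr Er} => ? ?; case: p' {pr' Er'} => ? ? /= -> ->; rewrite Err.
Qed.

(** * The total weight of the triangles as a determinant *)

Section TriangleSum.
Variables (R : comNzRingType) (X Y : int -> R) (c : nat -> int -> R) (lo hi : int).

Definition entry_weight (p : int * bool) : R := if p.2 then X p.1 else Y p.1.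

Definition raw_weight m (T : seq (seq int)) (D : seq (seq bool)) : R :=
  \prod_(k < m) \prod_(i < k.+1) entry_weight (entry T k i, orient D k i).

(** These two properties abstract the coefficients of q_t. The bounds [lo] and [hi] confine the
    recurrence to the actual labels. *)
Hypothesis c0 : forall t, c 0 t = 1.
Hypothesis cS : forall j t, lo <= t < hi ->
  c j.+1 (t + 1) - c j.+1 t = X t * c j t + Y (t + 1) * c j (t + 1).

(** Pairing the right-oriented value t with the left-oriented value t + 1 gives the right-hand side
    of [cS], so the sum telescopes. *)
Lemma sum_cell j a b : lo <= a -> a <= b -> b <= hi ->
  \sum_(p <- cell a b) entry_weight p * c j p.1 = c j.+1 b - c j.+1 a.
Proof.
move=> lo_a le_ab b_hi; rewrite big_cat !big_map /= -big_split /=.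
have -> : c j.+1 b = c j.+1 (a + `|b - a|%N%:Z) by congr c; lia.
have : a + `|b - a|%N%:Z <= hi by lia.
move: `|b - a|%N => k; rewrite -[k in iota _ k]subn0 -/(index_iota 0 k).
elim: k => [|k IHk] le_k; first by rewrite big_geq // addr0 subrr.
rewrite big_nat_recr //= IHk; last by lia.
have -> : a + k.+1%:Z = a + k%:Z + 1 by lia.
rewrite /entry_weight /= -cS; last by lia.
by rewrite addrC subrKA.
Qed.

(* The determinant is antisymmetric in the entries of a row, so rows that      *)
(* interlace without being strict may be added to the sum for free.            *)
Lemma sum_triangles m s : size s = m.+1 -> strict s ->
    all (fun t => lo <= t <= hi) s ->
  \sum_(p <- triangles m s) raw_weight m p.1 p.2 =
  \det (\matrix_(i < m.+1, j < m.+1) c j (nth 0 s i)).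
Proof.
elim: m s => [|m IHm] s szs ss rs.
  rewrite big_seq1 /raw_weight big_ord0 (_ : matrix_of_fun _ _ = 1%:M) ?det1 //.
  by apply/matrixP => i j; rewrite !mxE !ord1 c0.
have s_range i : (i < m.+2)%N -> lo <= nth 0 s i <= hi.
  by move=> lt_i; apply: (allP rs); rewrite mem_nth // szs.
rewrite /= big_allpairs_dep big_filter big_mkcond /=.
transitivity (\sum_(r <- selections (row_cells s))
    (\prod_(i < m.+1) entry_weight (nth (0, false) r i)) *
    \det (\matrix_(i < m.+1, j < m.+1) c j (nth (0, false) r i).1)).
  apply: eq_big_seq => r /(mem_row_selections _ ss)[].
  rewrite szs /= => szr r_cell.
  have nth1 i : (i < m.+1)%N -> nth 0 (unzip1 r) i = (nth (0, false) r i).1.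
    by move=> lt_i; rewrite (nth_map (0, false)) ?szr.
  have cellP i : (i < m.+1)%N ->
      nth 0 s i <= (nth (0, false) r i).1 <= nth 0 s i.+1.
    move=> lt_i; move: (r_cell i lt_i); rewrite /in_cell.
    by case: (nth _ r i) => z [] /=; lia.
  case: ifPn => [sr|nsr].
    have szr1 : size (unzip1 r) = m.+1 by rewrite size_map.
    have rr : all (fun t => lo <= t <= hi) (unzip1 r).
      apply/(all_nthP 0) => i; rewrite szr1 => lt_i; rewrite nth1 //.
      have := cellP i lt_i; have := s_range i (leqW lt_i); have := s_range i.+1 lt_i.
      lia.
    rewrite (_ : matrix_of_fun _ _ =
      \matrix_(i < m.+1, j < m.+1) c j (nth 0 (unzip1 r) i)); last first.
      by apply/matrixP => i j; rewrite !mxE nth1.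
    rewrite -IHm // big_distrr /=; apply: eq_big_seq => p.
    move=> /(mem_triangles _ szr1 sr)[shT _ lastT shD _].
    have szT := shape_size shT; have szD := shape_size shD.
    rewrite {1}/raw_weight big_ord_recr /= mulrC; congr (_ * _).
      apply: eq_bigr => i _; rewrite /entry /orient !nth_rcons szT szD ltnSn ltnn eqxx.
      have -> : nth [::] p.1 m = unzip1 r by rewrite -lastT -nth_last szT.
      by rewrite nth1 // (nth_map (0, false)) ?szr.
    apply: eq_bigr => k _; apply: eq_bigr => i _.
    by rewrite /entry /orient !nth_rcons szT szD ltnS ltn_ord (ltnW (ltn_ord k)).
  (* At a failure of strictness, r_i <= s_(i+1) <= r_(i+1) forces r_i = r_(i+1), so the matrix has
     two equal rows. *)
  have [i nlt_i|lt_r] := pickP [pred i : 'I_m |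
      ~~ ((nth (0, false) r i).1 < (nth (0, false) r i.+1).1)]; last first.
    case/negP: nsr; apply/(sortedP 0) => i; rewrite size_map szr => lt_i.
    rewrite !nth1 ?(ltnW lt_i) //.
    by have /negbFE := lt_r (Ordinal (lt_i : (i < m)%N)).
  rewrite (determinant_alternate (i1 := widen_ord (leqnSn m) i)
    (i2 := lift ord0 i)) ?mulr0 // => [|j].
    by rewrite -val_eqE /= /bump add1n ltn_eqF.
  rewrite !mxE /= /bump /= add1n; congr c.
  have := cellP i (ltnW (ltn_ord i)); have := cellP i.+1 (ltn_ord i).
  by move: nlt_i => /=; lia.
rewrite (sum_selections_det _ entry_weight (fun j a => c j a.1)); last first.
  by rewrite size_row_cells szs.
rewrite [RHS]det_row_diff => [|i]; last by rewrite mxE c0.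
congr (\det _); apply/matrixP => i j; rewrite !mxE /= /bump !add1n.
rewrite nth_row_cells ?szs // sum_cell //.
- by have := s_range i (leqW (ltn_ord i)); lia.
- by apply/ltW/strict_nth; rewrite ?szs // ltnS.
- by have := s_range i.+1 (ltn_ord i); lia.
Qed.

End TriangleSum.

(** The converse uses strictness of the row below: an entry between equal neighbours would satisfy
    the orientation rules vacuously, while its cell is empty. *)
Lemma valid_complete m T D :
  valid_triangle m [seq j%:Z | j <- iota 1 m.+1] T D <->
  complete_monotone m.+1 T && admissible_orientation m.+1 T D.
Proof.
have entry_lt k i : shape T = iota 1 m.+1 -> all strict T -> (k < m)%N ->
    (i <= k)%N -> entry T k.+1 i < entry T k.+1 i.+1.
  move=> shT sT lt_k le_i; have szT := shape_size shT.
  apply: strict_nth; first by apply: (allP sT); rewrite mem_nth ?szT.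
  have := congr1 (nth 0%N ^~ k.+1) shT.
  by rewrite nth_iota // /shape (nth_map [::]) ?szT // => ->.
split=> [[shT sT lastT shD H]|].
  rewrite /complete_monotone /admissible_orientation shT shD sT lastT !eqxx /=.
  by apply/andP; split; apply/forallP => k; apply/forallP => i /=;
    have := H k i (ltn_ord k) (ltn_ord i); rewrite /in_cell /=; case: ifP => _; lia.
case/andP => /and4P[/eqP shT sT /eqP lastT /forallP HT] /andP[/eqP shD /forallP HD].
split=> // k i lt_k le_i; rewrite /in_cell /=.
have /forallP/(_ (Ordinal (le_i : (i < k.+1)%N))) /= := HT (Ordinal lt_k).
have /forallP/(_ (Ordinal (le_i : (i < k.+1)%N))) /= := HD (Ordinal lt_k).
have := entry_lt k i shT sT lt_k le_i.
by case: ifP => _; lia.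
Qed.

Lemma strict_iota m : strict [seq j%:Z | j <- iota 1 m].
Proof. by rewrite sorted_map; apply: iota_ltn_sorted. Qed.

Lemma sum_complete_triangles (R : comNzRingType) (X Y : int -> R) m :
  \sum_(p <- triangles m [seq j%:Z | j <- iota 1 m.+1]) raw_weight X Y m p.1 p.2 =
  \prod_(i < m.+1) \prod_(j < m.+1 | (i < j)%N) (X i.+1%:Z + Y j.+1%:Z).
Proof.
set s := [seq _ | _ <- _].
pose x i := X i.+1%:Z; pose y i := Y i.+1%:Z.
(* The predecessor converts the label t >= 1 into an index counted from 0. *)
pose c j (t : int) := (factor_poly x m.+1 y `|t|.-1)`_j.
have nth_s i : (i < m.+1)%N -> nth 0 s i = i.+1%:Z.
  by move=> lt_i; rewrite (nth_map 0%N) ?size_iota // nth_iota.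
have szs : size s = m.+1 by rewrite size_map size_iota.
have rs : all (fun t : int => 1 <= t <= m.+1%:Z) s.
  by apply/allP => z /mapP[j]; rewrite mem_iota => ? ->; lia.
have c0 t : c 0%N t = 1 by rewrite /c coef0_factor_poly.
have cS j (t : int) : 1 <= t < m.+1%:Z ->
    c j.+1 (t + 1) - c j.+1 t = X t * c j t + Y (t + 1) * c j (t + 1).
  case: t => [[|t]|t] // /andP[_ lt_t]; have {}lt_t : (t < m)%N by lia.
  rewrite -[_ + 1]/(t.+1 + 1)%N%:Z addn1 /c /= -coefB factor_polyB //.
  rewrite -[X t.+1%:Z]/(x t) -[Y t.+2%:Z]/(y t.+1) -!coefZ -coefD factor_polyD //.
  by rewrite !coefZ coefXM.
rewrite (sum_triangles c0 cS szs (strict_iota _) rs).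
rewrite -(det_factor_poly x m.+1 y); congr (\det _); apply/matrixP => i j.
by rewrite !mxE /c nth_s.
Qed.

(** * The total weight of the tournaments *)

Section TournamentSum.
Variables (R : comNzRingType) (n : nat) (x y : 'I_n -> R).
Implicit Types (t J : {set 'I_n * 'I_n}) (e : 'I_n * 'I_n).

Definition ascending : {set 'I_n * 'I_n} := [set e : 'I_n * 'I_n | (e.1 < e.2)%N].

(** A tournament is determined by its ascending edges [J]; every other pair is oriented
    downwards. *)
Definition tournament_of J : {set 'I_n * 'I_n} :=
  [set e : 'I_n * 'I_n | if (e.1 < e.2)%N then e \in J
           else (e.2 < e.1)%N && ((e.2, e.1) \notin J)].

Lemma tournament_ofP J : is_tournament (tournament_of J).
Proof.
apply/andP; split; first by apply/forallP => i; rewrite inE /= ltnn.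
apply/forallP => i; apply/forallP => j; apply/implyP.
rewrite -val_eqE /= !inE /=; case: ltngtP => //= _ _.
  by case: (_ \in J).
by case: (_ \in J).
Qed.

Lemma tournament_of_ascending t :
  is_tournament t -> tournament_of (t :&: ascending) = t.
Proof.
case/andP=> /forallP irr /forallP asym; apply/setP => -[i j].
rewrite !inE /=; case: ltngtP => /= [_|lt_ji|/val_inj->].
- by rewrite andbT.
- have /forallP/(_ i)/implyP := asym j; rewrite -val_eqE /= andbT => /(_ _).
  by rewrite ltn_eqF // => /(_ isT); do 2!case: (_ \in t).
- by rewrite (negPf (irr j)).
Qed.

Lemma ascending_tournament_of J :
  (tournament_of J :&: ascending == J) = (J \subset ascending).
Proof.
apply/eqP/idP => [<-|/subsetP JU]; first exact: subsetIr.
apply/setP => e; rewrite !inE; case: (boolP (e \in J)) => [/JU|].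
  by rewrite inE => ->.
by case: ifP; rewrite ?andbF.
Qed.

Lemma prod_tournament_of J :
  \prod_(e in tournament_of J) (if (e.1 < e.2)%N then x e.1 else y e.1) =
  \prod_(e in ascending) (if e \in J then x e.1 else y e.2).
Proof.
rewrite (bigID [pred e : 'I_n * 'I_n | (e.1 < e.2)%N]).
rewrite [RHS](bigID [pred e : 'I_n * 'I_n | e \in J]) /=.
congr (_ * _).
  rewrite [RHS](eq_bigr (fun e => x e.1)) => [|e /andP[_ ->]//].
  apply: eq_big => [e|e /andP[_ ->]//]; rewrite !inE.
  by case: ifP; rewrite ?andbT ?andbF.
rewrite [RHS](eq_bigr (fun e => y e.2)) => [|e /andP[_ /negPf->]//].
rewrite (eq_bigr (fun e => y e.1)) => [|e /andP[_ /negPf->]//].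
(* Swapping ends sends the descending edges to the ascending pairs outside [J]. *)
rewrite (reindex_inj (h := fun e => (e.2, e.1))) => [|[? ?] [? ?] [-> ->]//] /=.
by apply: eq_bigl => -[i j]; rewrite !inE /=; case: ltngtP; rewrite ?andbT ?andbF.
Qed.

Lemma sum_tournaments :
  \sum_(t : {set 'I_n * 'I_n} | is_tournament t)
     \prod_(e in t) (if (e.1 < e.2)%N then x e.1 else y e.1) =
  \prod_(i < n) \prod_(j < n | (i < j)%N) (x i + y j).
Proof.
rewrite pair_big_dep /=.
(* After expansion over sets [J], the value 0 of [F] kills each [J] with a non-ascending pair, and
   the value 1 of [G] makes non-ascending pairs outside [J] neutral. *)
pose F e := if e \in ascending then x e.1 else 0.
pose G e := if e \in ascending then y e.2 else 1.
transitivity (\prod_e (F e + G e)); last first.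
  rewrite [RHS]big_mkcond /=; apply: eq_bigr => e _; rewrite /F /G inE.
  by case: ifP; rewrite ?add0r.
rewrite bigA_distr (reindex_onto tournament_of (fun t => t :&: ascending)) /=;
  last exact: tournament_of_ascending.
rewrite big_mkcond /=; apply: eq_bigr => J _.
rewrite tournament_ofP ascending_tournament_of /=.
case: ifPn => [JU|/subsetPn[e eJ eU]]; last first.
  by rewrite (bigD1 e) //= eJ /F (negPf eU) mul0r.
rewrite prod_tournament_of // big_mkcond /=; apply: eq_bigr => e _.
rewrite /F /G; case: (boolP (e \in J)) => [/(subsetP JU)->//|_].
by case: ifP.
Qed.

End TournamentSum.

(** * From equal sums of monomials to a bijection *)

Definition monomial N (p : {mpoly int[N]}) : Prop := exists m, p = 'X_[m].

Lemma monomial_prod N (I : Type) (r : seq I) (P : pred I) (F : I -> {mpoly int[N]}) :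
  (forall i, P i -> monomial (F i)) -> monomial (\prod_(i <- r | P i) F i).
Proof.
move=> FM; apply: big_ind => //; first by exists 0%MM; rewrite mpolyX0.
by move=> _ _ [m1 ->] [m2 ->]; exists (m1 + m2)%MM; rewrite mpolyXD.
Qed.

Lemma mcoeff_sum_monomials N (A : seq {mpoly int[N]}) m :
  (forall p, p \in A -> monomial p) ->
  (\sum_(p <- A) p)@_m = (count_mem 'X_[m] A)%:R.
Proof.
elim: A => [|p A IHA] AM; first by rewrite big_nil mcoeff0.
rewrite big_cons mcoeffD IHA => [|q qA]; last by apply: AM; rewrite inE qA orbT.
have [m' ->] := AM p (mem_head _ _).
rewrite mcoeffX /= natrD; congr (_%:R + _).
have [->|ne_m] := eqVneq; first by rewrite eqxx.
suff /negPf-> : 'X_[m'] != 'X_[m] :> {mpoly int[N]} by [].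
apply/eqP => /(congr1 (mcoeff m)); rewrite !mcoeffX eqxx (negPf ne_m).
by move/eqP; rewrite eq_sym oner_eq0.
Qed.

Lemma perm_eq_monomials N (A B : seq {mpoly int[N]}) :
    (forall p, p \in A -> monomial p) -> (forall p, p \in B -> monomial p) ->
  \sum_(p <- A) p = \sum_(p <- B) p -> perm_eq A B.
Proof.
move=> AM BM eqAB; apply/allP => p; rewrite mem_cat => pAB /=.
have [m ->] : monomial p by case/orP: pAB; [apply: AM | apply: BM].
have := congr1 (mcoeff m) eqAB; rewrite !mcoeff_sum_monomials // => /eqP.
by rewrite eqr_nat.
Qed.

Lemma perm_map_bijective (A B C : eqType) (P : pred A) (Q : pred B)
    (sA : seq A) (sB : seq B) (wA : A -> C) (wB : B -> C) :
    uniq sA -> uniq sB -> sA =i P -> sB =i Q ->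
    perm_eq (map wA sA) (map wB sB) ->
  exists f : {a | P a} -> {b | Q b},
    bijective f /\ forall a, wB (val (f a)) = wA (val a).
Proof.
move=> uA uB memA memB perm_w.
have sz_AB : size sA = size sB by have := perm_size perm_w; rewrite !size_map.
have PA a : P a = (a \in sA) by rewrite memA.
have QB b : Q b = (b \in sB) by rewrite memB.
(* [nth] needs default elements; without them both lists, hence both subtypes, are empty. *)
have empty_or : sA = [::] \/ exists (a0 : A) (b0 : B), true.
  by case: (sA) (sB) sz_AB => [|a0 ?] [|b0 ?] //; [left | right; exists a0, b0].
case: empty_or => [sA0|[a0 [b0 _]]].
  have noA (a : {a | P a}) : False by move: (valP a); rewrite PA sA0.
  have noB (b : {b | Q b}) : False.
    by move: (valP b); rewrite QB; case: (sB) sz_AB; rewrite sA0.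
  exists (fun a => False_rect _ (noA a)); split=> [|a]; last by case: (noA a).
  by exists (fun b => False_rect _ (noB b)) => [a|b]; [case: (noA a) | case: (noB b)].
have /(perm_iotaP (wA a0))[Is permI wE] := perm_w.
rewrite size_map in permI.
have szI : size Is = size sB by rewrite (perm_size permI) size_iota.
have uI : uniq Is by rewrite (perm_uniq permI) iota_uniq.
have memI i : (i \in Is) = (i < size sB)%N by rewrite (perm_mem permI) mem_iota.
(* [Is] permutes positions so that position i of [sA] and position [Is][i] of [sB] carry the same
   weight; [g] and [h] follow it in the two directions. *)
pose g a := nth b0 sB (nth 0%N Is (index a sA)).
pose h b := nth a0 sA (index (index b sB) Is).
have lt_nth a : a \in sA -> (nth 0%N Is (index a sA) < size sB)%N.
  by move=> aA; rewrite -memI mem_nth // szI -sz_AB index_mem.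
have gB (a : {a | P a}) : Q (g (val a)).
  by rewrite QB mem_nth // lt_nth // -PA (valP a).
have hA (b : {b | Q b}) : P (h (val b)).
  by rewrite PA mem_nth // sz_AB -szI index_mem memI index_mem -QB (valP b).
exists (fun a => exist (fun b => Q b) _ (gB a)); split.
  exists (fun b => exist (fun a => P a) _ (hA b)) => [[a Pa]|[b Qb]];
    apply: val_inj => /=.
    have aA : a \in sA by rewrite -PA.
    by rewrite /h /g !index_uniq ?nth_index ?lt_nth // szI -sz_AB index_mem.
  have bB : b \in sB by rewrite -QB.
  rewrite /h /g index_uniq // ?nth_index ?memI ?index_mem //.
  by rewrite sz_AB -szI index_mem memI index_mem.
case=> a Pa /=; have aA : a \in sA by rewrite -PA.
have := congr1 (nth (wA a0) ^~ (index a sA)) wE.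
rewrite (nth_map a0) ?index_mem // nth_index // => ->.
rewrite (nth_map 0%N) ?szI -?sz_AB ?index_mem //.
by rewrite (nth_map b0) // lt_nth.
Qed.

Lemma monomial_xvar n (j : int) : 1 <= j <= n%:Z -> monomial (xvar n j).
Proof.
rewrite /xvar; case: pickP => [i _ _|no_j]; first by exists U_(lshift n i)%MM.
case: j no_j => [[|j]|] //= no_j lt_j; have lt_jn : (j < n)%N by lia.
by have := no_j (Ordinal lt_jn); rewrite /= eqxx.
Qed.

Lemma monomial_yvar n (j : int) : 1 <= j <= n%:Z -> monomial (yvar n j).
Proof.
rewrite /yvar; case: pickP => [i _ _|no_j]; first by exists U_(rshift n i)%MM.
case: j no_j => [[|j]|] //= no_j lt_j; have lt_jn : (j < n)%N by lia.
by have := no_j (Ordinal lt_jn); rewrite /= eqxx.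
Qed.

Lemma oriented_triangle_enum n :
  exists2 sA : seq (seq (seq int) * seq (seq bool)),
    uniq sA /\ sA =i (fun p => complete_monotone n p.1
                            && admissible_orientation n p.1 p.2)
  & \sum_(p <- sA) raw_weight (xvar n) (yvar n) n.-1 p.1 p.2 =
    \prod_(i < n) \prod_(j < n | (i < j)%N) (xvar n i.+1%:Z + yvar n j.+1%:Z).
Proof.
(* [triangles] starts at order 1; order 0 has only the empty triangle, of weight 1. *)
case: n => [|m].
  exists [:: ([::], [::])]; last by rewrite big_seq1 /raw_weight !big_ord0.
  split=> // -[T D]; rewrite inE; apply/eqP/andP => [[-> ->]|[]] /=.
    by split; apply/and4P || apply/andP; split=> //; apply/forallP => -[].
  by case/andP=> /eqP/shape_size/size0nil-> _ /andP[/eqP/shape_size/size0nil-> _].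
set s := [seq j%:Z | j <- iota 1 m.+1].
have szs : size s = m.+1 by rewrite size_map size_iota.
have ss : strict s := strict_iota _.
exists (triangles m s); last exact: sum_complete_triangles.
split=> [|p]; first exact: triangles_uniq.
by apply/idP/idP => [/(mem_triangles _ szs ss)/valid_complete//|H];
  apply/(mem_triangles _ szs ss)/valid_complete.
Qed.

Theorem theorem1 (n : nat) :
  exists f : oriented_triangle n -> tournament n,
    bijective f /\
    forall o : oriented_triangle n, tournament_weight (f o) = triangle_weight o.
Proof.
have [sA [uA memA] sumA] := oriented_triangle_enum n.
pose sB := enum (fun t : {set 'I_n * 'I_n} => is_tournament t).
pose wA p := raw_weight (xvar n) (yvar n) n.-1 p.1 p.2.
pose wB (t : {set 'I_n * 'I_n}) :=
  \prod_(e in t) (if (e.1 < e.2)%N then xvar n e.1.+1%:Z else yvar n e.1.+1%:Z).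
apply: (perm_map_bijective (sA := sA) (sB := sB) (wA := wA) (wB := wB)) => //.
- exact: enum_uniq.
- by move=> t; rewrite mem_enum.
apply: perm_eq_monomials => [p /mapP[q qA ->]|p /mapP[t _ ->]|].
(* The entry range matters here: outside 1, ..., n the variables default to 0, which is not a
   monomial. *)
- move: qA; rewrite memA => /andP[cq _].
  apply: monomial_prod => k _; apply: monomial_prod => i _.
  have := complete_monotone_entry_range (k := k) (i := i) cq.
  have lt_k := ltn_ord k; have lt_i := ltn_ord i => /(_ _ _) range.
  rewrite /entry_weight /=; case: ifP => _.
    by apply/monomial_xvar/range; lia.
  by apply/monomial_yvar/range; lia.
- apply: monomial_prod => e _; have lt_e := ltn_ord e.1.
  by case: ifP => _; [apply: monomial_xvar | apply: monomial_yvar]; lia.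
rewrite !big_map /wA sumA /sB big_enum /=; symmetry.
exact: (sum_tournaments (fun i : 'I_n => xvar n i.+1%:Z) (fun i => yvar n i.+1%:Z)).
Qed.
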